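(* Let $L$ satisfy (1)–(3) of the context and be generic in the sense of the context, with unique Mather measure $\mu$. Let $\epsilon_i,h_i\to0$ be sequences of positive numbers such that $\phi_{\epsilon_i,h_i}\to\phi_0$ and $\bar\phi_{\epsilon_i,h_i}\to\bar\phi_0$ uniformly; below $\lim_{\epsilon,h\to0}$ refers to the limit along these sequences. Let $D=\mathrm{dom}(\nabla\phi_0)\subset\mathbb{T}^N$ be the set of points where $\phi_0$ is differentiable, and let $A\subset D\times\mathbb{R}^N$ be such that $\pi_1(A)\cap\pi_1(\operatorname{supp}(\mu))=\emptyset$. If $A$ is closed and bounded, then $$\limsup_{\epsilon,h\to0}\epsilon h\ln\mu_{\epsilon,h}(A)\le-\inf_{x\in\pi_1(A)}\{\bar\phi_0(x)+\phi_0(x)\},$$ and if $A$ is open and bounded, then $$\liminf_{\epsilon,h\to0}\epsilon h\ln\mu_{\epsilon,h}(A)\ge-\inf_{x\in\pi_1(A)}\{\bar\phi_0(x)+\phi_0(x)\}.$$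
   Context: $\mathbb{T}^N=\mathbb{R}^N/\mathbb{Z}^N$; functions on $\mathbb{T}^N$ are identified with $\mathbb{Z}^N$-periodic functions on $\mathbb{R}^N$; $\pi_1:\mathbb{T}^N\times\mathbb{R}^N\to\mathbb{T}^N$ is the projection to the first factor. The Lagrangian $L:\mathbb{R}^N\times\mathbb{R}^N\to\mathbb{R}$ is of class $C^2$, $\mathbb{Z}^N$-periodic in $x$, and satisfies: (1) $\lim_{|v|\to\infty}L(x,v)/|v|=+\infty$ uniformly in $x$; (2) the Hessian $\left(\partial^2L/\partial v_i\partial v_j\right)(x,v)$ is positive definite; (3) there are constants $C,\Gamma>0$ with $L(x+y,v-z)+L(x-y,v+z)-2L(x,v)\le C|y|^2+\Gamma|z|^2$ for all $x,y,v,z$. A Mather measure is a probability measure on $\mathbb{T}^N\times\mathbb{R}^N$ minimizing $\int L\,d\mu$ among probability measures invariant under the Euler–Lagrange flow of $L$; $\overline H_0$ is the minimal value. With $\Phi(x,y)$ the infimum of $\int_0^T(L(\gamma,\dot\gamma)-\overline H_0)dt$ over $T>0$ and absolutely continuous $\gamma:[0,T]\to\mathbb{T}^N$ from $x$ to $y$, the Aubry set $\hat{\mathcal A}(L)$ is the set of $(x,v)$ such that the Euler–Lagrange solution $\gamma$ with $\gamma(0)=x,\dot\gamma(0)=v$ satisfies $\int_a^b(L(\gamma,\dot\gamma)-\overline H_0)dt=-\Phi(\gamma(b),\gamma(a))$ for all $a<b$. ''$L$ is generic'' means: there is exactly one Mather measure $\mu$, and $\operatorname{supp}(\mu)=\hat{\mathcal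 A}(L)$. $H(p,x)=\sup_v(-p\cdot v-L(x,v))$. For generic $L$ the viscosity solutions of $H(\nabla\phi(x),x)=-\overline H_0$ and of $H(-\nabla\bar\phi(x),x)=-\overline H_0$ are unique up to additive constants; $\phi_0$ and $\bar\phi_0$ denote these solutions (with the additive constants fixed by being the limits in the claim). For $\epsilon,h>0$ and continuous $\phi:\mathbb{T}^N\to\mathbb{R}$ set $$\mathcal G[\phi](x)=-\epsilon h\ln\int_{\mathbb{R}^N}e^{-\frac{hL(x,v)+\phi(x+hv)}{\epsilon h}}dv,\qquad \bar{\mathcal G}[\phi](x)=-\epsilon h\ln\int_{\mathbb{R}^N}e^{-\frac{hL(x-hv,v)+\phi(x-hv)}{\epsilon h}}dv.$$ $\phi_{\epsilon,h},\bar\phi_{\epsilon,h}$ are $\mathbb{Z}^N$-periodic Lipschitz functions (with semiconcavity modulus bounded uniformly in $\epsilon$ and small $h$) and $\lambda_{\epsilon,h}\in\mathbb{R}$ a constant with $\mathcal G[\phi_{\epsilon,h}]=\phi_{\epsilon,h}+\lambda_{\epsilon,h}$, $\bar{\mathcal G}[\bar\phi_{\epsilon,h}]=\bar\phi_{\epsilon,h}+\lambda_{\epsilon,h}$, normalized by $\phi_{\epsilon,h}(0)=0$ and $\int_{\mathbb{T}^N}e^{-\frac{\bar\phi_{\epsilon,h}+\phi_{\epsilon,h}}{\epsilon h}}dx=1$. $\mu_{\epsilon,h}$ is the probability measure with density $$\mu_{\epsilon,h}(x,v)=e^{-\frac{\bar\phi_{\epsilon,h}(x)+\phi_{\epsilon,h}(x)}{\epsilon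 h}}\,e^{-\frac{hL(x,v)+\phi_{\epsilon,h}(x+hv)-\phi_{\epsilon,h}(x)-\lambda_{\epsilon,h}}{\epsilon h}}.$$ *)

(* Defs.v *)
From HB Require Import structures.
From mathcomp Require Import all_boot all_order all_algebra.
From mathcomp Require Import all_classical all_reals all_analysis.
Set Implicit Arguments.
Unset Strict Implicit.
Unset Printing Implicit Defensive.
Import Order.TTheory GRing.Theory Num.Theory.
Import numFieldNormedType.Exports.
Local Open Scope classical_set_scope.
Local Open Scope ring_scope.

Section lebesgue_tuple.
Variable R : realType.

Local Notation T := (measurableTypeR R).

Definition tcons n (p : T * n.-tuple T) : n.+1.-tuple T :=
  [the n.+1.-tuple T of p.1 :: p.2].

Lemma measurable_tcons n : measurable_fun [set: T * n.-tuple T] (@tcons n).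
Proof. exact: measurable_cons. Qed.

Lemma measurable_tuncons n :
  measurable_fun [set: n.+1.-tuple T] (fun t => (thead t, [tuple of behead t])).
Proof.
by apply: measurable_fun_pair; [exact: measurable_tnth|exact: measurable_behead].
Qed.

Section step.
Variables (n : nat) (m : {sigma_finite_measure set (n.-tuple T) -> \bar R}).

Definition leb_cons : set (n.+1.-tuple T) -> \bar R :=
  pushforward (lebesgue_measure \x m)%E (@tcons n).

Let leb_cons0 : leb_cons set0 = 0%E.
Proof. by rewrite /leb_cons /pushforward preimage_set0 measure0. Qed.

Let leb_cons_ge0 A : (0 <= leb_cons A)%E.
Proof. by rewrite /leb_cons /pushforward; exact: measure_ge0. Qed.

Let leb_cons_sigma_additive : semi_sigma_additive leb_cons.
Proof.
move=> F mF tF mUF; rewrite /leb_cons /pushforward preimage_bigcup.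
have mpre k : measurable (@tcons n @^-1` F k).
  by rewrite -[X in measurable X]setTI; exact: measurable_tcons.
apply: measure_semi_sigma_additive => //; last exact: bigcupT_measurable.
apply/trivIsetP => /= i j _ _ ij; rewrite -preimage_setI.
by move/trivIsetP : tF => /(_ _ _ _ _ ij) ->//; rewrite preimage_set0.
Qed.

HB.instance Definition _ := isMeasure.Build _ _ _ leb_cons
  leb_cons0 leb_cons_ge0 leb_cons_sigma_additive.

Let leb_cons_sigma_finite : sigma_finite setT leb_cons.
Proof.
pose un (t : n.+1.-tuple T) : T * n.-tuple T := (thead t, [tuple of behead t]).
have [F FT Foo] := sigma_finiteT (@lebesgue_measure R).
have [G GT Goo] := sigma_finiteT m.
have mFG k l : measurable (F k `*` G l).
  by apply: measurableX; [have [] := Foo k|have [] := Goo l].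
pose FG (kl : nat * nat) := un @^-1` (F kl.1 `*` G kl.2).
exists (fun k => if unpickle k is Some kl then FG kl else set0).
  apply/esym; rewrite -subTset => t _.
  have [[k _ Fk] _] : (\bigcup_i F i) (thead t) /\ True by split=> //; rewrite -FT.
  have [l _ Gl] : (\bigcup_i G i) [tuple of behead t] by rewrite -GT.
  by exists (pickle (k, l)) => //=; rewrite pickleK.
move=> i; case: unpickle => [[k l]|]; last first.
  by split=> //; rewrite measure0.
split.
  by rewrite -[X in measurable X]setTI; exact: measurable_tuncons.
rewrite /leb_cons /pushforward (_ : _ @^-1` _ = F k `*` G l); last first.
  apply/seteqP; split => -[x y]; rewrite /FG /un/= theadE;
    by rewrite (_ : [tuple of behead (x :: y)] = y)//; exact/val_inj.
have [? ?] := Foo k; have [? ?] := Goo l.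
by rewrite product_measure1E// lte_mul_pinfty// ge0_fin_numE.
Qed.

HB.instance Definition _ := Measure_isSigmaFinite.Build _ _ _ leb_cons
  leb_cons_sigma_finite.

End step.

Fixpoint leb_tuple n : {sigma_finite_measure set (n.-tuple T) -> \bar R} :=
  if n is n'.+1 then leb_cons (leb_tuple n') else \d_([tuple] : 0.-tuple T).

Lemma leb_tuple_box n (A : 'I_n -> set T) : (forall i, measurable (A i)) ->
  (leb_tuple n [set t | forall i, A i (tnth t i)] =
   \prod_(i < n) lebesgue_measure (A i))%E.
Proof.
elim: n A => [|n ih] A mA.
  by rewrite big_ord0 /= diracE mem_set// => -[].
pose B : set (n.-tuple T) := [set t | forall i, A (lift ord0 i) (tnth t i)].
have mB : measurable B.
  rewrite (_ : B = \bigcap_(i in [set: 'I_n])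
      ((@tnth n T ^~ i) @^-1` A (lift ord0 i))); last first.
    by apply/seteqP; split => [t Bt i _|t Bt i]; exact: Bt.
  apply: fin_bigcap_measurable => // i _.
  by rewrite -[X in measurable X]setTI; exact: measurable_tnth.
rewrite big_ord_recl -ih//= /leb_cons /pushforward.
rewrite (_ : _ @^-1` _ = A ord0 `*` B) ?product_measure1E//.
apply/seteqP; split => -[x t] /=.
  move=> At; split; first exact: (At ord0).
  by move=> i; have := At (lift ord0 i); rewrite tnthS.
move=> [Ax Bt] i; case: (unliftP ord0 i) => [j ->|->]; last exact: Ax.
by rewrite tnthS; exact: Bt.
Qed.

End lebesgue_tuple.

Section euclidean.
Variables (R : realType) (N : nat).
Implicit Types x y v w : 'rV[R]_N.

Definition dot x y : R := \sum_(i < N) x 0 i * y 0 i.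

(* The Euclidean norm; the norm `|x| carried by 'rV[R]_N is the sup norm. *)
Definition enorm x : R := Num.sqrt (dot x x).

Definition rowt (t : N.-tuple (measurableTypeR R)) : 'rV[R]_N :=
  \row_i tnth t i.

Definition unit_cube : set (N.-tuple (measurableTypeR R)) :=
  [set t | forall i, 0 <= tnth t i < 1].

Definition int_vect x : bool := [forall i, x 0 i \is a Num.int].

Definition periodic T (f : 'rV[R]_N -> T) : Prop :=
  forall x k, int_vect k -> f (x + k) = f x.

Definition torus_eq x y : bool := int_vect (x - y).

Lemma torus_eq_refl : reflexive torus_eq.
Proof.
by move=> x; rewrite /torus_eq subrr; apply/forallP => i; rewrite mxE rpred0.
Qed.

Lemma torus_eq_sym : symmetric torus_eq.
Proof.
by move=> x y; apply: eq_forallb => i; rewrite -opprB mxE rpredN.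
Qed.

Lemma torus_eq_trans : transitive torus_eq.
Proof.
move=> y x z /forallP xy /forallP yz; apply/forallP => i.
by have := rpredD (xy i) (yz i); rewrite !mxE addrA subrK.
Qed.

Canonical torus_equiv := EquivRel torus_eq torus_eq_refl torus_eq_sym
  torus_eq_trans.

Definition torus := quotient_topology {eq_quot torus_equiv}%qT.

Definition toT : 'rV[R]_N -> torus := \pi_torus%qT.

Definition liftT : torus -> 'rV[R]_N := repr.

End euclidean.

Arguments unit_cube {R N}.
Arguments toT {R N} _.
Arguments liftT {R N} _.

Lemma periodic_lift (R : realType) (N : nat) T (f : 'rV[R]_N -> T) x :
  periodic f -> f (liftT (toT x)) = f x.
Proof.
move=> pf; rewrite -[in LHS](subrK x (liftT _)) addrC pf//.
have /eqmodP : toT (liftT (toT x)) = toT x by exact: reprK.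
by [].
Qed.

Section smoothness.
Variables (R : realType) (V : normedModType R).

(* Meant for finite-dimensional V, where they are the usual classes C^1, C^2. *)
Definition C1 (f : V -> R) : Prop :=
  (forall x, differentiable f x) /\ (forall w, continuous ('D_w f)).

Definition C2 (f : V -> R) : Prop := C1 f /\ forall w, C1 ('D_w f).

End smoothness.

Section mather.
Variables (R : realType) (N : nat).

Local Notation E := 'rV[R]_N.
Local Notation TN := (torus R N).

Implicit Types (L : E * E -> R) (x y v w z p : E).

Definition hess_v L (z : E * E) : 'M[R]_N :=
  \matrix_(i, j) 'D_((0 : E), (delta_mx 0 i : E))
                   ('D_((0 : E), (delta_mx 0 j : E)) L) z.

Record lagrangian L : Prop := Lagrangian {
  lag_C2 : C2 L ;
  lag_periodic : forall v, periodic (fun x => L (x, v)) ;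
  lag_superlinear : forall M : R, exists r : R, forall x v,
    r < enorm v -> M < L (x, v) / enorm v ;
  lag_convex : forall x v w, w != 0 -> 0 < (w *m hess_v L (x, v) *m w^T) 0 0 ;
  lag_semiconcave : exists C Gam : R, [/\ 0 < C, 0 < Gam &
    forall x v y z,
      L (x + y, v - z) + L (x - y, v + z) - 2 * L (x, v)
        <= C * enorm y ^+ 2 + Gam * enorm z ^+ 2] }.

Definition EL_solution L (g : R -> E) : Prop :=
  [/\ forall t : R, derivable g t 1,
      continuous (derive1 g) &
      forall (t : R) (i : 'I_N),
        is_derive t (1 : R)
          (fun s => 'D_((0 : E), (delta_mx 0 i : E)) L (g s, derive1 g s))
          ('D_((delta_mx 0 i : E), (0 : E)) L (g t, derive1 g t))].

(* For a Lagrangian as above there is exactly one such solution, defined for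
   all times by conservation of energy on the compact torus. *)
Definition EL_traj L x v : R -> E :=
  get [set g | [/\ EL_solution L g, g 0 = x & derive1 g 0 = v]].

Definition EL_flow L (t : R) (z : TN * E) : TN * E :=
  let g := EL_traj L (liftT z.1) z.2 in (toT (g t), derive1 g t).

Definition phase := g_sigma_algebraType (@open (TN * E)%type).

Definition action L (mu : probability phase R) : \bar R :=
  (\int[mu]_z (L (liftT z.1, z.2))%:E)%E.

Definition EL_invariant L (mu : probability phase R) : Prop :=
  forall (t : R) (B : set phase), measurable B ->
    mu (EL_flow L t @^-1` B) = mu B.

Definition mather_measure L (mu : probability phase R) : Prop :=
  EL_invariant L mu /\
  forall nu : probability phase R, EL_invariant L nu ->
    (action L mu <= action L nu)%E.

Definition Hbar0 L : R :=
  fine (ereal_inf [set action L mu | mu in EL_invariant L]).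

Definition msupport (mu : set (TN * E) -> \bar R) : set (TN * E) :=
  [set z | forall U, open U -> U z -> (0 < mu U)%E].

Definition abs_continuous (a b : R) (g : R -> E) : Prop :=
  forall e : R, 0 < e -> exists2 d : R, 0 < d &
    forall (n : nat) (s t : 'I_n -> R),
      (forall i, [/\ a <= s i, s i <= t i & t i <= b]) ->
      (forall i j, i != j -> t i <= s j \/ t j <= s i) ->
      \sum_i (t i - s i) < d ->
      \sum_i enorm (g (t i) - g (s i)) < e.

Definition reduced_action L (a b : R) (g : R -> E) : \bar R :=
  (\int[lebesgue_measure]_(t in `[a, b]) (L (g t, derive1 g t) - Hbar0 L)%:E)%E.

(* Absolutely continuous curves in the torus are projections of absolutely
   continuous curves in the covering space. *)
Definition Phi L (p q : TN) : \bar R :=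
  ereal_inf [set A | exists T (g : R -> E),
    [/\ 0 < T, abs_continuous 0 T g, toT (g 0) = p, toT (g T) = q &
        A = reduced_action L 0 T g]].

Definition aubry L : set (TN * E) :=
  [set z | let g := EL_traj L (liftT z.1) z.2 in
    forall a b, a < b ->
      (reduced_action L a b g = - Phi L (toT (g b)) (toT (g a)))%E].

Definition generic L (mu : probability phase R) : Prop :=
  [/\ mather_measure L mu,
      forall nu : probability phase R, mather_measure L nu ->
        forall B, measurable B -> nu B = mu B &
      msupport mu = aubry L].

Definition hamiltonian L p x : \bar R :=
  ereal_sup [set (- dot p v - L (x, v))%:E | v in [set: E]].

Definition grad (f : E -> R) x : E := \row_i 'D_(delta_mx 0 i : E) f x.

Definition viscosity_subsolution (F : E -> E -> \bar R) (c : R)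
    (u : E -> R) : Prop :=
  forall (psi : E -> R) x, C1 psi ->
    (\forall y \near x, u y - psi y <= u x - psi x) ->
    (F (grad psi x) x <= c%:E)%E.

Definition viscosity_supersolution (F : E -> E -> \bar R) (c : R)
    (u : E -> R) : Prop :=
  forall (psi : E -> R) x, C1 psi ->
    (\forall y \near x, u x - psi x <= u y - psi y) ->
    (c%:E <= F (grad psi x) x)%E.

Definition viscosity_solution F c (u : E -> R) : Prop :=
  [/\ continuous u, periodic u,
      viscosity_subsolution F c u & viscosity_supersolution F c u].

Definition semiconcave (K : R) (u : E -> R) : Prop :=
  forall x y, u (x + y) + u (x - y) - 2 * u x <= K * enorm y ^+ 2.

End mather.

Section entropy_penalization.
Variables (R : realType) (N : nat).

Local Notation E := 'rV[R]_N.
Local Notation TN := (torus R N).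

Implicit Types (L : E * E -> R) (eps h lam : R) (phi phibar : E -> R).

Definition Gop L eps h phi (x : E) : \bar R :=
  (- ((eps * h)%:E * lne (\int[leb_tuple R N]_t
    (let v := rowt t in
     expR (- ((h * L (x, v) + phi (x + h *: v)) / (eps * h))))%:E)))%E.

Definition Gbarop L eps h phi (x : E) : \bar R :=
  (- ((eps * h)%:E * lne (\int[leb_tuple R N]_t
    (let v := rowt t in
     expR (- ((h * L (x - h *: v, v) + phi (x - h *: v)) / (eps * h))))%:E)))%E.

Definition mu_density L eps h phi phibar lam (x v : E) : R :=
  expR (- ((phibar x + phi x) / (eps * h))) *
  expR (- ((h * L (x, v) + phi (x + h *: v) - phi x - lam) / (eps * h))).

(* The density is Z^N-periodic in x, and Lebesgue measure on the torus is
   represented on the fundamental domain [0, 1)^N. *)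
Definition mu_eps L eps h phi phibar lam (A : set (TN * E)) : \bar R :=
  (\int[leb_tuple R N \x leb_tuple R N]_(z in
     [set z | unit_cube z.1 /\ A (toT (rowt z.1), rowt z.2)])
     (mu_density L eps h phi phibar lam (rowt z.1) (rowt z.2))%:E)%E.

Record eigen_pair L eps h phi phibar lam : Prop := EigenPair {
  eig_periodic : periodic phi ;
  eig_bar_periodic : periodic phibar ;
  eig_lipschitz : lipschitz phi ;
  eig_bar_lipschitz : lipschitz phibar ;
  eig_G : forall x, Gop L eps h phi x = (phi x + lam)%:E ;
  eig_bar_G : forall x, Gbarop L eps h phibar x = (phibar x + lam)%:E ;
  eig_norm0 : phi 0 = 0 ;
  eig_norm1 : (\int[leb_tuple R N]_(t in unit_cube)
    (expR (- ((phibar (rowt t) + phi (rowt t)) / (eps * h))))%:E = 1)%E }.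

Definition dom_grad phi : set TN := toT @` [set x | differentiable phi x].

Definition rate phi0 phibar0 (A : set (TN * E)) : \bar R :=
  ereal_inf [set (phibar0 x + phi0 x)%:E | x in toT @^-1` (fst @` A)].

End entropy_penalization.

(* Main.v *)
(* On bounded sets of velocities the logarithm of the density, scaled by
   eps * h, tends uniformly to -(phibar0 + phi0), because every remaining term
   of the exponent is negligible: h L is O(h); phi(x + h v) - phi(x) tends to 0
   since a uniform limit of Lipschitz functions is uniformly continuous; and
   lam tends to 0, as one sees by evaluating the eigenvalue equation near a
   minimum and near a maximum of phi. Laplace's principle then only compares
   mu(A) with the Lebesgue measure of a box containing A (upper bound) or
   of a small box inside A (lower bound). *)
Require Import Defs.
From HB Require Import structures.
From mathcomp Require Import all_boot all_order all_algebra.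
From mathcomp Require Import all_classical all_reals all_analysis.
From mathcomp Require Import ring lra.
Set Implicit Arguments.
Unset Strict Implicit.
Unset Printing Implicit Defensive.
Import Order.TTheory GRing.Theory Num.Theory.
Import numFieldNormedType.Exports.
Local Open Scope classical_set_scope.
Local Open Scope ring_scope.

(** * Comparison of integrals through simple minorants *)

Section upper_lower_integral.
Context d (T : measurableType d) (R : realType).
Variable m : {measure set T -> \bar R}.
Implicit Types (D B : set T) (f g : T -> \bar R).
Import HBNNSimple.
Local Open Scope ereal_scope.

(* The integral of a nonnegative function is a supremum over simple minorants,
   so neither monotonicity nor homogeneity requires measurability. *)
Lemma ge0_le_integral_nonmeasurable D B f g : D `<=` B ->
  (forall x, D x -> 0 <= f x <= g x) -> (forall x, B x -> 0 <= g x) ->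
  \int[m]_(x in D) f x <= \int[m]_(x in B) g x.
Proof.
move=> DB fg g0.
rewrite !ge0_integralE//; last by move=> x /fg /andP[].
apply: ereal_sup_le => _ [s /= sf <-]; exists s => // x.
apply: le_trans (sf x) _; rewrite !patchE.
case: ifPn => [/set_mem Dx|_].
  by rewrite mem_set; [case/andP: (fg _ Dx)|exact: DB].
by case: ifPn => // /set_mem/g0.
Qed.

(** Dividing a simple minorant of [k * f] by [k] gives a simple minorant of [f]. *)
Lemma ge0_integralZl_le_nonmeasurable (k : R) f : (0 < k)%R ->
  (forall x, 0 <= f x) -> \int[m]_x (k%:E * f x) <= k%:E * \int[m]_x f x.
Proof.
move=> k0 f0; rewrite !ge0_integralTE//; last first.
  by move=> x; rewrite mule_ge0// lee_fin ltW.
apply: ge_ereal_sup => _ [s /= sf <-].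
have ki0 : (0 <= k^-1)%R by rewrite invr_ge0 ltW.
have -> : sintegral m s = k%:E * sintegral m (scale_nnsfun s ki0).
  rewrite -[sintegral m (scale_nnsfun _ _)]/(sintegral m (cst k^-1 \* s)%R).
  by rewrite sintegralrM muleA -EFinM divff ?gt_eqF// mul1e.
rewrite lee_pmul2l//; apply: ereal_sup_ubound; exists (scale_nnsfun s ki0) => //= x.
by rewrite EFinM lee_pdivrMl.
Qed.

(** Meant for [B] a product of boxes of known volume and [D] the part of it cut out by [A]. *)
Lemma integral_le_cst D B f (c : R) : measurable B -> D `<=` B -> (0 <= c)%R ->
  (forall x, D x -> 0 <= f x <= c%:E) -> \int[m]_(x in D) f x <= c%:E * m B.
Proof.
move=> mB DB c0 fc; rewrite -integral_cst//.
by apply: ge0_le_integral_nonmeasurable.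
Qed.

Lemma integral_ge_cst D B f (c : R) : measurable B -> B `<=` D -> (0 <= c)%R ->
  (forall x, B x -> c%:E <= f x) -> (forall x, D x -> 0 <= f x) ->
  c%:E * m B <= \int[m]_(x in D) f x.
Proof.
move=> mB BD c0 cf f0; rewrite -integral_cst//.
by apply: ge0_le_integral_nonmeasurable => // x /cf; rewrite lee_fin c0.
Qed.

End upper_lower_integral.

(** * Upper and lower limits of extended real sequences *)

Section limits.
Variable R : realType.
Implicit Types (u : nat -> \bar R) (a : R).
Local Open Scope ereal_scope.

(** The upper limit is an infimum, over the sets of the filter, of suprema of [u]; the set where
    [u i <= a + e] is one of these sets. *)
Lemma limn_esup_le u a :
  (forall e : R, (0 < e)%R -> \forall i \near \oo, u i <= (a + e)%:E) ->
  limn_esup u <= a%:E.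
Proof.
move=> ua; apply/lee_addgt0Pr => e /ua uae; rewrite -EFinD.
rewrite /limn_esup limf_esupE.
apply: (@le_trans _ _ (ereal_sup (u @` [set i | u i <= (a + e)%:E]))).
  by apply: ereal_inf_lbound; exists [set i | u i <= (a + e)%:E].
by apply: ge_ereal_sup => _ [i /= ? <-].
Qed.

Lemma limn_einf_ge u a :
  (forall e : R, (0 < e)%R -> \forall i \near \oo, (a - e)%:E <= u i) ->
  a%:E <= limn_einf u.
Proof.
move=> ua; apply/lee_subgt0Pr => e /ua uae; rewrite -EFinB.
rewrite [leRHS](_ : _ = limf_einf u \oo)// limf_einfE.
apply: (@le_trans _ _ (ereal_inf (u @` [set i | (a - e)%:E <= u i]))); last first.
  by apply: ereal_sup_ubound; exists [set i | (a - e)%:E <= u i].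
by apply: le_ereal_inf_tmp => _ [i /= ? <-].
Qed.

End limits.

(** * Boxes and their volume *)

Section boxes.
Variables (R : realType) (N : nat).
Local Notation T := (measurableTypeR R).
Implicit Types (a b : 'I_N -> R).

(** Half-open like the fundamental domain, which is thus itself a box; a box may also have a point
    of the domain as its lower corner. *)
Definition box a b : set (N.-tuple T) :=
  [set t | forall i, tnth t i \in `[a i, b i[].

Lemma measurable_box a b : measurable (box a b).
Proof.
rewrite (_ : box a b = \bigcap_(i in [set: 'I_N])
    ((@tnth N T ^~ i) @^-1` [set` `[a i, b i[])); last first.
  by apply/seteqP; split => [t Bt i _|t Bt i]; exact: Bt.
apply: fin_bigcap_measurable => // i _.
by rewrite -[X in measurable X]setTI; exact: measurable_tnth.
Qed.

Lemma leb_tuple_itv_box a b : (forall i, a i < b i) ->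
  leb_tuple R N (box a b) = (\prod_(i < N) (b i - a i))%:E.
Proof.
move=> ab.
rewrite [LHS](@leb_tuple_box R N (fun i => [set` `[a i, b i[]))//.
rewrite -prodEFin; apply: eq_bigr => i _.
by rewrite lebesgue_measure_itv/= lte_fin ab EFinB.
Qed.

End boxes.

(** * Sup norm and reduction to the fundamental domain *)

Section torus_coordinates.
Variables (R : realType) (N : nat).
Local Notation E := 'rV[R]_N.
Implicit Types x v : E.

Lemma rowV_norm_le v (r : R) : 0 <= r -> (forall i, `|v 0 i| <= r) -> `|v| <= r.
Proof.
move=> r0 vr; rewrite [`|v|]mx_normrE; apply/bigmax_leP; split => // -[i j] _ /=.
by rewrite ord1.
Qed.

Lemma rowV_coord_le v i : `|v 0 i| <= `|v|.
Proof.
rewrite [`|v|]mx_normrE.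
by rewrite (le_bigmax _ (fun k : 'I_1 * 'I_N => `|v k.1 k.2|) (0, i)).
Qed.

Lemma norm_le_enorm v : `|v| <= enorm v.
Proof.
apply: rowV_norm_le => [|i]; first exact: sqrtr_ge0.
rewrite -[leLHS]sqrtr_sqr ler_sqrt ?sumr_ge0// => [|j _]; last exact: sqr_ge0.
by rewrite /dot (bigD1 i)//= -expr2 lerDl sumr_ge0// => j _; exact: sqr_ge0.
Qed.

Lemma unit_cube_shift x : exists2 k : E, int_vect k &
  forall i, 0 <= (x + k) 0 i < 1.
Proof.
exists (\row_i (- (Num.floor (x 0 i))%:~R)) => [|i].
  by apply/forallP => i; rewrite mxE rpredN; exact: intr_int.
rewrite !mxE subr_ge0 ltrBlDl real_floor_le ?num_real//=.
by rewrite -intrD1 real_floorD1_gt ?num_real.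
Qed.

Lemma unit_cube_norm x : (forall i, 0 <= x 0 i < 1) -> `|x| <= 1.
Proof.
move=> x01; apply: rowV_norm_le => // i.
by have /andP[x0 x1] := x01 i; rewrite ger0_norm// ltW.
Qed.

Lemma periodic_lipschitz_bounded (f : E -> R) : Defs.periodic f -> lipschitz f ->
  exists B, forall x, `|f x| <= B.
Proof.
move=> pf /pinfty_ex_gt0[K K0 fK].
exists (`|f 0| + K) => x.
have [k kint xk] := unit_cube_shift x.
rewrite -(pf x k kint); set y := x + k.
rewrite -[f y](subrK (f 0)) addrC.
apply: le_trans (ler_normD _ _) _; rewrite lerD2l.
have /= := fK (y, 0) (conj I I).
rewrite subr0 => /le_trans; apply.
by rewrite ler_piMr ?(ltW K0)//; exact: unit_cube_norm.
Qed.

End torus_coordinates.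

(** Stands in for an exact minimum on the torus; the error [e] is arbitrary and is removed at the
    end of the eigenvalue estimate. *)
Lemma almost_minimizer (R : realType) (T : pointedType) (f : T -> R) B (e : R) :
  (forall x, `|f x| <= B) -> 0 < e -> exists x, forall y, f x <= f y + e.
Proof.
move=> fB e0.
have fi : has_inf (range f).
  split; first by exists (f point), point.
  by exists (- B) => _ [x _ <-]; have := fB x; rewrite ler_norml => /andP[].
have [_ [x _ <-] fx] := inf_adherent e0 fi.
exists x => y; apply: le_trans (ltW fx) _; rewrite lerD2r.
by apply: ge_inf; [case: fi|exists y].
Qed.

(** * Bounds on the Lagrangian *)

Section lagrangian_bounds.
Variables (R : realType) (N : nat) (L : 'rV[R]_N * 'rV[R]_N -> R).
Hypothesis hL : lagrangian L.

(** Periodicity brings [x] into the unit ball, and a continuous function is bounded on a compact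
    product of balls. *)
Lemma lagrangian_bounded (M : R) :
  exists C, forall x v, `|v| <= M -> `|L (x, v)| <= C.
Proof.
pose b (r : R) := [set x : 'rV[R]_N | `|x| <= r].
have cb r : compact (b r).
  apply: bounded_closed_compact.
    by exists r; split; [exact: num_real|move=> y ry x /= /le_trans; apply; exact: ltW].
  rewrite (_ : b r = Num.norm @^-1` [set y | y <= r])//.
  by apply: closed_comp => [x _|]; [exact: norm_continuous|exact: closed_le].
have cL : continuous L.
  by move=> z; apply: differentiable_continuous; have [[+ _] _] := lag_C2 hL; exact.
have /compact_bounded/pinfty_ex_gt0[C C0 LC] :
    compact (L @` (b 1 `*` b M)).
  apply: continuous_compact; last exact: compact_setX.
  exact: continuous_subspaceT.
exists C => x v vM.
have [k kint xk] := unit_cube_shift x.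
rewrite -(lag_periodic hL v x kint).
apply: LC; exists (x + k, v) => //; split => //=.
exact: unit_cube_norm.
Qed.

(** Superlinear growth, taken with slope 0, makes [L] positive at large velocities; the remaining
    velocities form a bounded set. *)
Lemma lagrangian_lower_bound : exists2 c, 0 <= c & forall x v, - c <= L (x, v).
Proof.
have [r Lr] := lag_superlinear hL 0.
have [C LC] := lagrangian_bounded r.
exists `|C| => // x v; have [vr|rv] := leP (enorm v) r.
  have := LC x v (le_trans (norm_le_enorm v) vr); rewrite ler_norml => /andP[+ _].
  by apply: le_trans; rewrite lerN2 ler_norm.
apply: (@le_trans _ _ 0); first by rewrite oppr_le0.
have v0 : 0 <= enorm v by exact: sqrtr_ge0.
have := Lr x v rv; apply: contraTT; rewrite -ltNge -leNgt => Lv.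
by rewrite mulr_le0_ge0 ?invr_ge0// ltW.
Qed.

End lagrangian_bounds.

(** A finite right-hand side excludes [I = 0] and [I = +oo], where [lne] is infinite, so the
    equation can be exponentiated. *)
Lemma lne_eq_fin (R : realType) (c r : R) (I : \bar R) : 0 < c ->
  (- (c%:E * lne I) = r%:E)%E -> (0 <= I)%E -> I = (expR (- (r / c)))%:E.
Proof.
move=> c0; case: I => [s| |]//=; last by rewrite gt0_muley.
case: ifPn => [_|]; first by rewrite gt0_muleNy.
rewrite -ltNge => s0 -[<-] _.
by rewrite mulNr opprK mulrC mulKf ?gt_eqF// lnK.
Qed.

(** * Size of the eigenvalue *)

Section eigenvalue.
Variables (R : realType) (N : nat) (L : 'rV[R]_N * 'rV[R]_N -> R).
Hypothesis hL : lagrangian L.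
Variables (phi phibar : R -> R -> 'rV[R]_N -> R) (lam : R -> R -> R).
Hypothesis hphi : forall eps h : R, 0 < eps -> 0 < h ->
  eigen_pair L eps h (phi eps h) (phibar eps h) (lam eps h).

Lemma eigen_integral (eps h : R) x : 0 < eps -> 0 < h ->
  (\int[leb_tuple R N]_t (expR (- ((h * L (x, rowt t) +
    phi eps h (x + h *: rowt t)) / (eps * h))))%:E =
  (expR (- ((phi eps h x + lam eps h) / (eps * h))))%:E)%E.
Proof.
move=> e0 h0; apply: lne_eq_fin; first exact: mulr_gt0.
  exact: eig_G (hphi e0 h0) x.
by apply: integral_ge0 => t _; rewrite lee_fin expR_ge0.
Qed.

(* The eigenvalue equation at eps = h = 1 already gives integrability. *)
Lemma exp_lagrangian_integral_bounded : exists2 K : R, 0 < K &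
  forall x, (\int[leb_tuple R N]_t (expR (- L (x, rowt t)))%:E <= K%:E)%E.
Proof.
have ep := hphi (@ltr01 R) (@ltr01 R).
have [B phiB] := periodic_lipschitz_bounded (eig_periodic ep) (eig_lipschitz ep).
(* The first factor absorbs [phi] at the shifted point inside the integral, the second bounds the
   right-hand side of the eigenvalue equation. *)
exists (expR B * expR (B - lam 1 1)) => [|x]; first by rewrite mulr_gt0 ?expR_gt0.
pose f t := (expR (- ((1 * L (x, rowt t) + phi 1 1 (x + 1 *: rowt t)) / (1 * 1))))%:E.
apply: (@le_trans _ _ (\int[leb_tuple R N]_t ((expR B)%:E * f t))%E).
  apply: ge0_le_integral_nonmeasurable => // t _; last first.
    by rewrite -EFinM lee_fin mulr_ge0 ?expR_ge0.
  rewrite -EFinM !lee_fin expR_ge0/= -expRD ler_expR.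
  have := phiB (x + 1 *: rowt t); rewrite ler_norml => /andP[_].
  rewrite !mul1r divr1; lra.
apply: le_trans (ge0_integralZl_le_nonmeasurable _ _ _) _.
- exact: expR_gt0.
- by move=> t; rewrite lee_fin expR_ge0.
rewrite /f eigen_integral// -EFinM lee_fin ler_pM2l ?expR_gt0// ler_expR.
have := phiB x; rewrite ler_norml => /andP[+ _].
rewrite mul1r divr1; lra.
Qed.

(** Near a minimum of [phi] the integral is at most a constant times that of [expR (- L)], which
    bounds [lam] below; near a maximum, the velocities of the unit box alone bound it above. *)
Lemma eigenvalue_bound : exists C, forall eps h, 0 < eps <= 1 -> 0 < h ->
  `|lam eps h| <= h * C + eps * h * C.
Proof.
have [K K0 LK] := exp_lagrangian_integral_bounded.
have [c c0 Lc] := lagrangian_lower_bound hL.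
have [C LC] := lagrangian_bounded hL 1.
have C0 : 0 <= C by apply: le_trans (LC 0 0 _); rewrite ?normr0.
have aK : ln K <= `|ln K| by exact: ler_norm.
exists (c + C + `|ln K|) => eps h /andP[e0 e1] h0.
have ep := hphi e0 h0; have eh0 : 0 < eps * h by exact: mulr_gt0.
have [B phiB] := periodic_lipschitz_bounded (eig_periodic ep) (eig_lipschitz ep).
have hc : 0 <= h * c by rewrite mulr_ge0// ltW.
have hC : 0 <= h * C by rewrite mulr_ge0// ltW.
have hK : 0 <= h * `|ln K| by rewrite mulr_ge0// ltW.
have ehc : 0 <= eps * h * c by rewrite mulr_ge0// ltW.
have ehC : 0 <= eps * h * C by rewrite mulr_ge0// ltW.
have ehK : eps * h * ln K <= eps * h * `|ln K| by rewrite ler_pM2l.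
have ehK0 : 0 <= eps * h * `|ln K| by rewrite mulr_ge0// ltW.
(* The slack [d] is the error allowed to the almost extremal points. *)
apply/ler_addgt0Pr => d d0.
rewrite ler_norml; apply/andP; split.
- have [x xmin] := almost_minimizer phiB d0.
  suff : - (phi eps h x + lam eps h) <=
      h * c - (phi eps h x - d) + eps * h * ln K by lra.
  (* [a] is the exponent left once the integrable factor [expR (- L)] is split off. *)
  pose a := (h * c - (phi eps h x - d)) / (eps * h).
  suff : - ((phi eps h x + lam eps h) / (eps * h)) <= a + ln K.
    rewrite -mulNr ler_pdivrMr// mulrDl /a divfK ?gt_eqF//; lra.
  rewrite -ler_expR expRD lnK// -lee_fin -(eigen_integral x e0 h0) EFinM.
  apply: le_trans (lee_wpmul2l _ (LK x)); last by rewrite lee_fin expR_ge0.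
  apply: le_trans _ (ge0_integralZl_le_nonmeasurable _ _ _); last 2 first.
  - exact: expR_gt0.
  - by move=> t; rewrite lee_fin expR_ge0.
  apply: ge0_le_integral_nonmeasurable => // t _.
  rewrite -EFinM !lee_fin expR_ge0/= -expRD ler_expR.
  rewrite -mulNr ler_pdivrMr// mulrDl /a divfK ?gt_eqF//.
  have := xmin (x + h *: rowt t).
  (* Since [eps <= 1], this gives [L / eps >= L - c / eps], which trades the weight
     [expR (- L / eps)] for [expR (- L)]. *)
  have : 0 <= (1 - eps) * h * (L (x, rowt t) + c).
    apply: mulr_ge0; last by have := Lc x (rowt t); lra.
    by rewrite mulr_ge0 ?subr_ge0// ltW.
  nra.
- have NphiB y : `|- phi eps h y| <= B by rewrite normrN.
  have [x xmax] := almost_minimizer NphiB d0.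
  suff : - (h * C + phi eps h x + d) <= - (phi eps h x + lam eps h) by lra.
  have ieh0 : 0 < (eps * h)^-1 by rewrite invr_gt0.
  rewrite -(ler_pM2r ieh0) !mulNr.
  rewrite -ler_expR -lee_fin -(eigen_integral x e0 h0).
  (* The unit box has volume 1 and [L <= C] on it, so a lower bound of the integrand there is one of
     the integral. *)
  have mQ := @measurable_box R N (fun=> 0) (fun=> 1).
  have Q1 : leb_tuple R N (box (fun=> 0) (fun=> 1)) = 1%E.
    by rewrite leb_tuple_itv_box// big1// => i _; rewrite subr0.
  rewrite -[leLHS]mule1 -Q1; apply: integral_ge_cst => // t Qt.
  rewrite lee_fin ler_expR lerN2 ler_pM2r//.
  have : L (x, rowt t) <= C.
    apply: le_trans (ler_norm _) (LC _ _ _); apply: unit_cube_norm => i.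
    by have := Qt i; rewrite in_itv/= mxE.
  move=> /(ler_wpM2l (ltW h0)); have := xmax (x + h *: rowt t) => /=; lra.
Qed.

End eigenvalue.

Lemma uniform_cvg_near (R : realType) (T : choiceType) (u : nat -> T -> R) f :
  {uniform, u @ \oo --> f} -> forall d, 0 < d ->
  \forall i \near \oo, forall x, `|u i x - f x| <= d.
Proof.
move=> uf d d0; apply: (uf [set g | forall x, `|g x - f x| <= d]).
apply/uniform_nbhs; exists [set xy | ball xy.1 d xy.2].
split; first exact: (entourage_ball R (PosNum d0)).
by move=> g fg x; rewrite distrC ltW//; exact: fg.
Qed.

Lemma null_seq_mul_le (R : realType) (u : nat -> R) (K d : R) :
  u @ \oo --> (0 : R) -> 0 < d -> \forall i \near \oo, u i * K <= d.
Proof.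
move=> uc d0.
have : (fun i => u i * K) @ \oo --> (0 : R).
  by rewrite -[0 : R](mul0r K); apply: cvgMl.
move=> /cvgrPdist_le/(_ d d0); apply: filterS => i.
by rewrite sub0r normrN; apply: le_trans; exact: ler_norm.
Qed.

(** * Uniform estimate of the density on bounded velocities *)

Section density_estimate.
Variables (R : realType) (N : nat) (L : 'rV[R]_N * 'rV[R]_N -> R).
Hypothesis hL : lagrangian L.
Variables (phi phibar : R -> R -> 'rV[R]_N -> R) (lam : R -> R -> R).
Hypothesis hphi : forall eps h : R, 0 < eps -> 0 < h ->
  eigen_pair L eps h (phi eps h) (phibar eps h) (lam eps h).
Variables (phi0 phibar0 : 'rV[R]_N -> R) (eps h : nat -> R).
Hypothesis eps_gt0 : forall i, 0 < eps i.
Hypothesis h_gt0 : forall i, 0 < h i.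
Hypothesis eps0 : eps @ \oo --> (0 : R).
Hypothesis h0 : h @ \oo --> (0 : R).
Hypothesis phi_cvg : {uniform, (fun i => phi (eps i) (h i)) @ \oo --> phi0}.
Hypothesis phibar_cvg :
  {uniform, (fun i => phibar (eps i) (h i)) @ \oo --> phibar0}.

(* One of the Lipschitz functions of the sequence, fixed once and for all,
   controls the oscillation of all the later ones. *)
Lemma eigenfunction_shift (M d : R) : 0 < d -> \forall i \near \oo,
  forall x v, `|v| <= M ->
    `|phi (eps i) (h i) (x + h i *: v) - phi (eps i) (h i) x| <= d.
Proof.
move=> d0.
(* Two points, each with the distances of the functions of index [i] and [j] to [phi0], make four
   shares; the Lipschitz estimate takes the fifth. *)
have d5 : 0 < d / 5 by rewrite divr_gt0.
have near5 := uniform_cvg_near phi_cvg d5.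
have [j phij] := filter_ex near5.
have [k k0 lipj] :=
  pinfty_ex_gt0 (eig_lipschitz (hphi (eps_gt0 j) (h_gt0 j))).
have kM := null_seq_mul_le (k * M) h0 d5.
near=> i => x v vM.
have phii : forall x, `|phi (eps i) (h i) x - phi0 x| <= d / 5 by near: i.
have hi : h i * (k * M) <= d / 5 by near: i.
have : `|phi (eps j) (h j) (x + h i *: v) - phi (eps j) (h j) x| <= d / 5.
  have /= /le_trans := lipj (x + h i *: v, x) (conj I I); apply.
  rewrite addrAC subrr add0r normrZ gtr0_norm//.
  by apply: le_trans hi; rewrite mulrCA !ler_pM2l.
move: (phii x) (phii (x + h i *: v)) (phij x) (phij (x + h i *: v)).
rewrite !ler_norml; lra.
Unshelve. all: by end_near. Qed.

Lemma eigenvalue_cvg0 (d : R) : 0 < d ->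
  \forall i \near \oo, `|lam (eps i) (h i)| <= d.
Proof.
move=> d0; have [C lamC] := eigenvalue_bound hL hphi.
have d2 : 0 < d / 2 by rewrite divr_gt0.
near=> i.
have e1 : eps i * 1 <= 1 by near: i; exact: null_seq_mul_le.
rewrite mulr1 in e1.
(* The sign of [C] is unknown, hence the absolute value. *)
have hC : h i * `|C| <= d / 2 by near: i; exact: null_seq_mul_le.
have hC0 : 0 <= h i * `|C| by rewrite mulr_ge0// ltW.
have CC : h i * C <= h i * `|C| by rewrite ler_pM2l// ler_norm.
have : eps i * (h i * C) <= 1 * (h i * `|C|).
  apply: (@le_trans _ _ (eps i * (h i * `|C|))); first by rewrite ler_pM2l.
  by rewrite ler_wpM2r.
have := lamC (eps i) (h i); rewrite eps_gt0 e1 => /(_ isT (h_gt0 i)).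
rewrite mul1r mulrA; lra.
Unshelve. all: by end_near. Qed.

Lemma mu_density_near (M d : R) : 0 < d -> \forall i \near \oo,
  forall x v, `|v| <= M ->
    expR (- ((phibar0 x + phi0 x + d) / (eps i * h i))) <=
    mu_density L (eps i) (h i) (phi (eps i) (h i)) (phibar (eps i) (h i))
      (lam (eps i) (h i)) x v <=
    expR (- ((phibar0 x + phi0 x - d) / (eps i * h i))).
Proof.
move=> d0; have [C LC] := lagrangian_bounded hL M.
(* One share each for [phi], [phibar], the shift by [h v], [lam] and [h L]. *)
have d5 : 0 < d / 5 by rewrite divr_gt0.
near=> i => x v vM.
have eh0 : 0 < (eps i * h i)^-1 by rewrite invr_gt0 mulr_gt0.
have phii : forall x, `|phi (eps i) (h i) x - phi0 x| <= d / 5.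
  by near: i; exact: uniform_cvg_near.
have phibari : forall x, `|phibar (eps i) (h i) x - phibar0 x| <= d / 5.
  by near: i; exact: uniform_cvg_near.
have shifti : forall x v, `|v| <= M ->
    `|phi (eps i) (h i) (x + h i *: v) - phi (eps i) (h i) x| <= d / 5.
  by near: i; exact: eigenfunction_shift.
have lami : `|lam (eps i) (h i)| <= d / 5.
  by near: i; exact: eigenvalue_cvg0.
have hC : h i * C <= d / 5 by near: i; exact: null_seq_mul_le.
have hLi : `|h i * L (x, v)| <= d / 5.
  by rewrite normrM gtr0_norm//; apply: le_trans hC; rewrite ler_pM2l// LC.
rewrite /mu_density -expRD -opprD -mulrDl !ler_expR !lerN2 !ler_pM2r//.
move: (phii x) (phibari x) (shifti x v vM) lami hLi.
rewrite !ler_norml; lra.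
Unshelve. all: by end_near. Qed.

End density_estimate.

(** * Scaled logarithms of an exponential times a volume *)

Section scaled_log.
Variables (R : realType) (c K b : R) (x : \bar R).
Hypotheses (c0 : 0 < c) (K0 : 0 < K).
Local Open Scope ereal_scope.

(** The volume [K] contributes only [c * ln K], which vanishes in the limit when [c] is
    [eps * h]. *)
Lemma mul_lne_le : x <= (expR (b / c))%:E * K%:E ->
  c%:E * lne x <= (b + c * ln K)%:E.
Proof.
have -> : (b + c * ln K)%:E = c%:E * (b / c + ln K)%:E.
  by rewrite -EFinM mulrDr [(c * (b / c))%R]mulrC divfK ?gt_eqF.
rewrite lee_pmul2l// -EFinM -[X in (X + ln K)%R]expRK -lnM ?posrE ?expR_gt0//.
case: x => [y| |]//=; last by rewrite !leNye.
(* For [y <= 0] the value of [lne] is [-oo], and the bound is trivial. *)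
rewrite lee_fin => yK; case: ifPn => [_|]; first by rewrite leNye.
rewrite -ltNge => y0; rewrite lee_fin ler_ln ?posrE//.
by rewrite mulr_gt0 ?expR_gt0.
Qed.

Lemma mul_lne_ge : (expR (b / c))%:E * K%:E <= x ->
  (b + c * ln K)%:E <= c%:E * lne x.
Proof.
have -> : (b + c * ln K)%:E = c%:E * (b / c + ln K)%:E.
  by rewrite -EFinM mulrDr [(c * (b / c))%R]mulrC divfK ?gt_eqF.
rewrite lee_pmul2l// -EFinM -[X in (X + ln K)%R]expRK -lnM ?posrE ?expR_gt0//.
have eK : (0 < expR (b / c) * K)%R by rewrite mulr_gt0 ?expR_gt0.
case: x => [y| |]//=; rewrite ?leey// lee_fin => yK.
have y0 := lt_le_trans eK yK.
by rewrite ifF ?lee_fin ?ler_ln ?posrE//; apply: lt_geF.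
Qed.

End scaled_log.

(** * The quotient map and volumes in phase space *)

Section torus.
Variables (R : realType) (N : nat).
Implicit Types x k : 'rV[R]_N.

Lemma toTD x k : int_vect k -> toT (x + k) = toT x.
Proof. by move=> kint; apply/eqmodP; rewrite /= /torus_eq addrAC subrr add0r. Qed.

(** Continuity of the quotient map pulls a product neighbourhood back to the covering space. *)
Lemma open_torus_phase (A : set (torus R N * 'rV[R]_N)) x v : open A ->
  A (toT x, v) -> \forall z \near (x, v), A (toT z.1, z.2).
Proof.
move=> oA Axv.
have : nbhs (toT x, v) A by exact: open_nbhs_nbhs.
move=> [[P Q] /= [Px Qv] PQA].
exists (toT @^-1` P, Q) => [|[y w] /= [Py Qw]]; last exact: (PQA (toT y, w)).
by split => //; exact: pi_continuous Px.
Qed.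

Lemma leb_tuple_prod_box (a b a' b' : 'I_N -> R) :
  (forall i, a i < b i) -> (forall i, a' i < b' i) ->
  exists2 K : R, 0 < K &
    (leb_tuple R N \x leb_tuple R N)%E (box a b `*` box a' b') = K%:E.
Proof.
move=> ab ab'.
exists (\prod_(i < N) (b i - a i) * \prod_(i < N) (b' i - a' i)).
  by rewrite mulr_gt0// prodr_gt0// => i _; rewrite subr_gt0.
rewrite product_measure1E; [|exact: measurable_box..].
by rewrite EFinM -!leb_tuple_itv_box.
Qed.

End torus.

(** * The upper and lower large deviation bounds *)

Section large_deviations.
Variables (R : realType) (N : nat) (L : 'rV[R]_N * 'rV[R]_N -> R).
Hypothesis hL : lagrangian L.
Variables (phi phibar : R -> R -> 'rV[R]_N -> R) (lam : R -> R -> R).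
Hypothesis hphi : forall eps h : R, 0 < eps -> 0 < h ->
  eigen_pair L eps h (phi eps h) (phibar eps h) (lam eps h).
Variables (phi0 phibar0 : 'rV[R]_N -> R) (eps h : nat -> R).
Hypothesis eps_gt0 : forall i, 0 < eps i.
Hypothesis h_gt0 : forall i, 0 < h i.
Hypothesis eps0 : eps @ \oo --> (0 : R).
Hypothesis h0 : h @ \oo --> (0 : R).
Hypothesis phi_cvg : {uniform, (fun i => phi (eps i) (h i)) @ \oo --> phi0}.
Hypothesis phibar_cvg :
  {uniform, (fun i => phibar (eps i) (h i)) @ \oo --> phibar0}.
Variable A : set (torus R N * 'rV[R]_N).

Let muA i := mu_eps L (eps i) (h i) (phi (eps i) (h i))
  (phibar (eps i) (h i)) (lam (eps i) (h i)) A.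

Let epsh_mul_le (K d : R) : 0 < d ->
  \forall i \near \oo, eps i * h i * K <= d.
Proof.
apply: (@null_seq_mul_le _ (fun i => eps i * h i)).
by rewrite -[0 : R](mul0r 0); exact: cvgM.
Qed.

(** A real lower bound [c] replaces the infimum, which is infinite when [A] is empty. *)
Lemma large_deviation_upper (c : R) : bounded_set (snd @` A) ->
  (forall x v, A (toT x, v) -> c <= phibar0 x + phi0 x) ->
  (limn_esup (fun i => (eps i * h i)%:E * lne (muA i)) <= (- c)%:E)%E.
Proof.
move=> /pinfty_ex_gt0[M M0 AM] Ac; apply: limn_esup_le => e e0.
have e2 : 0 < e / 2 by rewrite divr_gt0.
(* The velocity side ends at [M + 1] because a half-open box must still contain [M]. *)
have [K K0 KE] : exists2 K : R, 0 < K & (leb_tuple R N \x leb_tuple R N)%E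
    (box (fun=> 0) (fun=> 1) `*` box (fun=> - M) (fun=> M + 1)) = K%:E.
  by apply: leb_tuple_prod_box => i; lra.
have := mu_density_near hL hphi eps_gt0 h_gt0 eps0 h0 phi_cvg phibar_cvg M e2.
have := epsh_mul_le (ln K) e2; apply: filterS2 => i lnK dens.
have eh0 : 0 < eps i * h i by rewrite mulr_gt0.
apply: (@le_trans _ _ (- (c - e / 2) + eps i * h i * ln K)%:E); last first.
  by rewrite lee_fin; lra.
apply: mul_lne_le => //; rewrite -KE; apply: integral_le_cst.
- by apply: measurableX; exact: measurable_box.
- move=> [t s] /= [Qt Ats]; split => [k|k] /=; rewrite in_itv/=; first exact: Qt.
  have : `|rowt s| <= M by apply: AM; exists (toT (rowt t), rowt s).
  move=> /(le_trans (rowV_coord_le _ k)); rewrite mxE ler_norml.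
  by move=> /andP[-> /=]; lra.
- exact: expR_ge0.
- move=> [t s] /= [Qt Ats]; rewrite !lee_fin mulr_ge0 ?expR_ge0//=.
  have : `|rowt s| <= M by apply: AM; exists (toT (rowt t), rowt s).
  move=> /(dens (rowt t))/andP[_] /le_trans; apply.
  rewrite ler_expR mulNr lerN2 ler_pM2r ?invr_gt0// lerD2r.
  exact: Ac Ats.
Qed.

(** One point of [A] at a time suffices: a small box at that point already carries enough mass. *)
Lemma large_deviation_lower x v : open A -> A (toT x, v) ->
  continuous phi0 -> continuous phibar0 ->
  Defs.periodic phi0 -> Defs.periodic phibar0 ->
  ((- (phibar0 x + phi0 x))%:E <=
    limn_einf (fun i => (eps i * h i)%:E * lne (muA i)))%E.
Proof.
move=> oA Axv cphi cphibar pphi pphibar.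
have csum : continuous (phibar0 \+ phi0).
  by move=> y; exact: (continuousD (cphibar y) (cphi y)).
(* [mu_eps] integrates over the unit cube, so [x] is moved there; neither [toT x] nor the periodic
   limits change. *)
have [k kint] := unit_cube_shift x.
rewrite -(pphi x k kint) -(pphibar x k kint).
move: Axv; rewrite -(toTD x kint); move: (x + k) => {kint k}x Axv x01.
apply: limn_einf_ge => e e0.
(* Three such quarters are spent: on the oscillation of [phibar0 + phi0], on the density and on the
   volume. *)
have e4 : 0 < e / 4 by rewrite divr_gt0.
have : \forall z \near (x, v), A (toT z.1, z.2) /\
    phibar0 z.1 + phi0 z.1 <= phibar0 x + phi0 x + e / 4.
  apply: filterI; first exact: open_torus_phase.
  have : \forall y \near x, phibar0 y + phi0 y <= phibar0 x + phi0 x + e / 4.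
    have /cvgrPdist_le/(_ _ e4) : phibar0 \+ phi0 @ x --> phibar0 x + phi0 x.
      exact: csum.
    by apply: filterS => y; rewrite ler_distlC => /andP[_].
  by exact: cvg_fst.
move=> /nbhs_ballP[r /= r0 Ar].
(* The box starts at [x] and is cut at 1 to stay in the unit cube; sides of at most [r / 2] keep it
   inside the ball of [Ar]. *)
pose a i := x 0 i; pose b i := Num.min 1 (x 0 i + r / 2).
pose a' i := v 0 i; pose b' i := v 0 i + r / 2.
have r2 : 0 < r / 2 by rewrite divr_gt0.
have ab i : a i < b i.
  by rewrite lt_min ltrDl r2 andbT; have /andP[] := x01 i.
have ab' i : a' i < b' i by rewrite ltrDl.
have [K K0 KE] := leb_tuple_prod_box ab ab'.
have near_box (u : 'rV[R]_N) t :
    (forall i, u 0 i <= tnth t i < u 0 i + r / 2) -> `|rowt t - u| <= r / 2.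
  move=> ut; apply: rowV_norm_le => [|i]; first exact: ltW.
  rewrite !mxE; have /andP[ui it] := ut i.
  by rewrite ger0_norm ?subr_ge0// lerBlDl ltW.
have box_near t s : box a b t -> box a' b' s ->
    [/\ A (toT (rowt t), rowt s),
      phibar0 (rowt t) + phi0 (rowt t) <= phibar0 x + phi0 x + e / 4 &
      `|rowt s| <= `|v| + r / 2].
  move=> Bt Bs.
  have tx : `|rowt t - x| <= r / 2.
    apply: near_box => i; have := Bt i; rewrite in_itv/= lt_min.
    by move=> /andP[-> /andP[]].
  have sv : `|rowt s - v| <= r / 2.
    by apply: near_box => i; have := Bs i; rewrite in_itv.
  have [|Ats phits] := Ar (rowt t, rowt s).
    by split; rewrite -ball_normE/= distrC; lra.
  by split => //; have := ler_distD 0 (rowt s) v; have := ler_normD (rowt s - v) v;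
    rewrite subrK; lra.
have := mu_density_near hL hphi eps_gt0 h_gt0 eps0 h0 phi_cvg phibar_cvg
  (`|v| + r / 2) e4.
have := epsh_mul_le (- ln K) e4; apply: filterS2 => i lnK dens.
have eh0 : 0 < eps i * h i by rewrite mulr_gt0.
apply: (@le_trans _ _
    (- (phibar0 x + phi0 x + e / 4 + e / 4) + eps i * h i * ln K)%:E).
  by rewrite lee_fin; lra.
apply: mul_lne_ge => //; rewrite -KE; apply: integral_ge_cst.
- by apply: measurableX; exact: measurable_box.
- move=> [t s] /= [Bt Bs]; split; last by have [] := box_near t s Bt Bs.
  move=> j; have := Bt j; rewrite in_itv/= lt_min => /andP[xt /andP[-> _]].
  by rewrite andbT (le_trans _ xt)//; have /andP[] := x01 j.
- exact: expR_ge0.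
- move=> [t s] /= [Bt Bs]; rewrite lee_fin.
  have [_ phit sM] := box_near t s Bt Bs.
  have /andP[+ _] := dens (rowt t) (rowt s) sM; apply: le_trans.
  by rewrite ler_expR mulNr lerN2 ler_pM2r ?invr_gt0// lerD2r.
- by move=> z _; rewrite lee_fin mulr_ge0 ?expR_ge0.
Qed.

End large_deviations.

Unset Implicit Arguments.

Theorem theorem12 (R : realType) (N : nat) (hN : (0 < N)%N)
  (L : 'rV[R]_N * 'rV[R]_N -> R) (hL : lagrangian L)
  (mu : probability (phase R N) R) (hmu : generic L mu)
  (phi phibar : R -> R -> 'rV[R]_N -> R) (lam : R -> R -> R)
  (hphi : forall eps h : R, 0 < eps -> 0 < h ->
    eigen_pair L eps h (phi eps h) (phibar eps h) (lam eps h))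
  (hsemi : exists K h0 : R, 0 < h0 /\
    forall eps h : R, 0 < eps -> 0 < h < h0 ->
      semiconcave K (phi eps h) /\ semiconcave K (phibar eps h))
  (phi0 phibar0 : 'rV[R]_N -> R)
  (hphi0 : viscosity_solution (hamiltonian L) (- Hbar0 L) phi0)
  (hphibar0 : viscosity_solution (fun p x => hamiltonian L (- p) x)
    (- Hbar0 L) phibar0)
  (eps h : nat -> R)
  (heps_gt0 : forall i, 0 < eps i) (hh_gt0 : forall i, 0 < h i)
  (heps : eps @ \oo --> (0 : R)) (hh : h @ \oo --> (0 : R))
  (hcvg : {uniform, (fun i => phi (eps i) (h i)) @ \oo --> phi0})
  (hcvgbar : {uniform, (fun i => phibar (eps i) (h i)) @ \oo --> phibar0})
  (A : set (torus R N * 'rV[R]_N))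
  (hAD : A `<=` dom_grad phi0 `*` [set: 'rV[R]_N])
  (hAmu : (fst @` A) `&` (fst @` msupport mu) = set0)
  (hAbnd : bounded_set (snd @` A)) :
  let muA i := mu_eps L (eps i) (h i) (phi (eps i) (h i))
    (phibar (eps i) (h i)) (lam (eps i) (h i)) A in
  (closed A ->
    (limn_esup (fun i => (eps i * h i)%:E * lne (muA i)) <=
      - rate phi0 phibar0 A)%E) /\
  (open A ->
    (- rate phi0 phibar0 A <=
      limn_einf (fun i => (eps i * h i)%:E * lne (muA i)))%E).

Proof.
move=> muA.
have [cphi pphi _ _] := hphi0; have [cphibar pphibar _ _] := hphibar0.
split => [_|oA].
  have upper c : (c%:E <= rate phi0 phibar0 A)%E ->
      (limn_esup (fun i => (eps i * h i)%:E * lne (muA i)) <= (- c)%:E)%E.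
    move=> cA; apply: (large_deviation_upper hL hphi heps_gt0 hh_gt0 heps hh hcvg
      hcvgbar) => // x v Axv.
    rewrite -lee_fin; apply: le_trans cA _.
    by apply: ereal_inf_lbound; exists x => //; exists (toT x, v).
  case: (rate phi0 phibar0 A) upper => [r upper|upper|_]; last exact: leey.
    exact: upper.
  (* With rate [+oo] every real [c] is admissible, which forces the upper limit to be [-oo]. *)
  move: (limn_esup _) upper => [l upper|upper|//].
    by have := upper (1 - l)%R (leey _); rewrite lee_fin opprB lerDl oppr_ge0 ler10.
  by have := upper 0%R (leey _).
(* Each [x] in the infimum comes with a velocity [v] above it, and the pointwise bound applies
   there. *)
rewrite leeNl; apply: le_ereal_inf_tmp => _ [x [[p v] /= Apv px] <-].
rewrite leeNl -EFinN; apply: (large_deviation_lower hL hphi heps_gt0 hh_gt0 heps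
  hh hcvg hcvgbar (v := v)) => //.
by rewrite -px.
Qed.
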